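(* Let $\rho:\mathbb{R}_+\to[0,1]$ be a mean field equilibrium and suppose that the set $$\{t\ge0:\ \rho(t)\text{ is strongly decreasing-transversal}\}$$ has nonempty interior. Then there does not exist a sequence $(\rho_n)_{n\ge1}$ of $n$-player equilibria Fatou converging to $\rho$ in probability.
   Context: ''Increasing'' means non-decreasing. $(\Omega,\mathcal{G},P)$ is a probability space with a right-continuous filtration $\mathbb{G}=(\mathcal{G}_t)_{t\ge0}$; $r\in\mathbb{R}$ and $c>0$ are constants. A family of c.d.f.s $(F_t)_{t\ge0}$ describes the signals of both games below: $F_t(y)=P\{Y^i_t\le y\}$. It is assumed that each $F_t$ admits a continuous density $f_t$. $n$-player game. $(Y^i)_{i\ge1}$ are $[0,\infty)$-valued processes which are right-continuous, increasing in $t$, $\mathbb{G}$-progressively measurable, and i.i.d. with common c.d.f. $F_t$ at time $t$; the $n$-player game has players $1,\dots,n$ with signals $Y^1,\dots,Y^n$. An $n$-player equilibrium is a $\mathbb{G}$-adapted process $\rho_n$ of the form $\rho_n(t)=\#\{j\le n:\tau^j\le t\}/n$, where $\tau^1,\dots,\tau^n$ are $\mathbb{G}$-stopping times with $\tau^i=\inf\{t\ge0:\alpha^i(t)\ge r\}$, $\alpha^i(t)=Y^i_t+c\rho_n^{-i}(t)$, $\rho_n^{-i}(t)=\#\{j\ne i:\tau^j\le t\}/n$. Mean field game. $(I,\mathcal{I},\lambda)$ is an atomless probability space and $(I\times\Omega,\Sigma,\mu)$ is a Fubini extension of $(I\times\Omega,\mathcal{I}\otimes\mathcal{G},\lambda\otimes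 P)$, i.e. a probability space extending the product such that for every $\mu$-integrable $f$ the sections $f(i,\cdot)$ and $f(\cdot,\omega)$ are integrable for a.e. $i$ and a.e. $\omega$, and both iterated integrals exist and equal $\int f\,d\mu$. For each $i\in I$, $Y^i$ is $[0,\infty)$-valued, right-continuous, increasing and $\mathbb{G}$-progressively measurable; for each $t$, $(i,\omega)\mapsto Y^i_t(\omega)$ is $\Sigma$-measurable and $(Y^i_t)_{i\in I}$ are $\lambda$-essentially pairwise i.i.d. with c.d.f. $F_t$ (for $\lambda$-a.e. $i$, $Y^i_t$ is independent of $Y^j_t$ for $\lambda$-a.e. $j$, with common c.d.f. $F_t$). A (deterministic) mean field equilibrium is a function $\rho:\mathbb{R}_+\to[0,1]$ such that $\rho(t)=\lambda\{i:\tau^i\le t\}$ ($P$-a.s.) for all $t\ge0$, where $\tau^i=\inf\{t:\alpha^i(t)\ge r\}$, $\alpha^i(t)=Y^i_t+c\rho(t)$, for $\lambda$-a.e. $i$. Standing assumptions: the times $\tau^i$ are a.s. finite. (They are the minimal optimizers of $\sup_\tau E[e^{r\tau}\mathbf{1}_{\{\theta^i>\tau\}\cup\{\theta^i=\infty\}}]$ over $\mathbb{G}$-stopping times, $\theta^i=\inf\{t:\int_0^t\alpha^i(s)ds=\mathcal{E}\}$ with $\mathcal{E}$ exponential and independent of $\mathbb{G}$; this value is assumed finite.) For fixed $t$, a solution $x\in[0,1]$ of $u+F_t(r-cu)=1$ is strongly decreasing-transversal if $\partial_u|_{u=x}[u+F_t(r-cu)]<0$, equivalently $f_t(r-cx)>c^{-1}$.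 A sequence $(\rho_n)$ of $n$-player equilibria Fatou converges in probability to a mean field equilibrium $\rho$ if there is a dense set $D\subseteq\mathbb{R}_+$ such that $\rho_n(t)\to\rho(t)$ in probability for all $t\in D$. *)

(* Defs.v *)
From mathcomp Require Export all_boot all_order all_algebra.
From mathcomp Require Export all_classical all_reals all_analysis.

Set Implicit Arguments.
Unset Strict Implicit.
Unset Printing Implicit Defensive.

Import Order.TTheory GRing.Theory Num.Theory.
Import numFieldNormedType.Exports.

Local Open Scope classical_set_scope.
Local Open Scope ring_scope.

(* Time is R_+: processes are total functions of t : R and every condition is
   only imposed for 0 <= t.
   A sigma-algebra other than the canonical one of a type is a set of sets S;
   measurability with respect to S is measurability on g_sigma_algebraType S. *)

Record right_continuous_filtration (R : realType) (d : measure_display)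
    (Omega : measurableType d) (G : R -> set (set Omega)) : Prop := {
  filtration_sigma_algebra : forall t, 0 <= t -> sigma_algebra setT (G t) ;
  filtration_measurable : forall t, 0 <= t -> G t `<=` measurable ;
  filtration_increasing : forall s t, 0 <= s -> s <= t -> G s `<=` G t ;
  filtration_right_continuous : forall t, 0 <= t ->
    G t = \bigcap_(s in [set s | t < s]) G s }.

Definition adapted (R : realType) (d : measure_display)
    (Omega : measurableType d) (G : R -> set (set Omega))
    (X : R -> Omega -> R) : Prop :=
  forall t, 0 <= t ->
    measurable_fun [set: g_sigma_algebraType (G t)]
      (X t : g_sigma_algebraType (G t) -> R).

Definition progressively_measurable (R : realType) (d : measure_display)
    (Omega : measurableType d) (G : R -> set (set Omega))
    (X : R -> Omega -> R) : Prop :=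
  forall t, 0 <= t ->
    measurable_fun (`[0, t] `*` [set: g_sigma_algebraType (G t)])
      (fun z : R * g_sigma_algebraType (G t) => X z.1 z.2).

Definition stopping_time (R : realType) (d : measure_display)
    (Omega : measurableType d) (G : R -> set (set Omega))
    (tau : Omega -> \bar R) : Prop :=
  (forall w, (0 <= tau w)%E) /\
  (forall t, 0 <= t -> G t [set w | (tau w <= t%:E)%E]).

Record signal_process (R : realType) (d : measure_display)
    (Omega : measurableType d) (G : R -> set (set Omega))
    (Y : R -> Omega -> R) : Prop := {
  signal_ge0 : forall t w, 0 <= t -> 0 <= Y t w ;
  signal_right_continuous : forall t w, 0 <= t ->
    Y s w @[s --> t^'+] --> Y t w ;
  signal_increasing : forall s t w, 0 <= s -> s <= t -> Y s w <= Y t w ;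
  signal_progressive : progressively_measurable G Y }.

Definition has_cdf (R : realType) (d : measure_display)
    (Omega : measurableType d) (P : probability Omega R)
    (X : Omega -> R) (F : R -> R) : Prop :=
  forall y, P [set w | X w <= y] = (F y)%:E.

Definition admits_continuous_density (R : realType) (F : R -> R) : Prop :=
  exists f : R -> R,
    [/\ continuous f, forall x, 0 <= f x &
        forall y, (F y)%:E =
          (\int[lebesgue_measure]_(x in `]-oo, y]) (f x)%:E)%E].

Definition independent2 (R : realType) (d : measure_display)
    (Omega : measurableType d) (P : probability Omega R)
    (X Y : Omega -> R) : Prop :=
  forall A B : set R, measurable A -> measurable B ->
    P (X @^-1` A `&` Y @^-1` B) = (P (X @^-1` A) * P (Y @^-1` B))%E.

Definition mutually_independent (R : realType) (d : measure_display)
    (Omega : measurableType d) (P : probability Omega R)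
    (X : nat -> Omega -> R) : Prop :=
  forall (s : seq nat) (A : nat -> set R), uniq s ->
    (forall i, measurable (A i)) ->
    P (\bigcap_(i in [set` s]) X i @^-1` A i) =
      (\prod_(i <- s) P (X i @^-1` A i))%E.

(* inf of the empty set is +oo. *)
Definition hitting_time (R : realType) (r : R) (a : R -> R) : \bar R :=
  ereal_inf [set t%:E | t in [set t : R | 0 <= t /\ r <= a t]].

Definition exponential_independent (R : realType) (d : measure_display)
    (Omega : measurableType d) (P : probability Omega R)
    (G : R -> set (set Omega)) (E : {RV P >-> R}) : Prop :=
  (forall A : set R, measurable A -> distribution P E A = exponential_prob 1 A)
  /\
  (forall (A : set R) (B : set Omega), measurable A ->
    <<s \bigcup_(t in [set t : R | 0 <= t]) G t >> B ->
    P (E @^-1` A `&` B) = (P (E @^-1` A) * P B)%E).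

Definition default_time (R : realType) (d : measure_display)
    (Omega : measurableType d) (E : Omega -> R)
    (alpha : R -> Omega -> R) (w : Omega) : \bar R :=
  ereal_inf [set t%:E | t in [set t : R | 0 <= t /\
    (\int[lebesgue_measure]_(s in `[0%R, t]) (alpha s w)%:E)%E = (E w)%:E]].

(* With r = 0 and tau = +oo the product r * tau is 0, so e^(r tau) = 1. *)
Definition stopping_value (R : realType) (d : measure_display)
    (Omega : measurableType d) (P : probability Omega R)
    (G : R -> set (set Omega)) (E : Omega -> R) (r : R)
    (alpha : R -> Omega -> R) : \bar R :=
  let theta := default_time E alpha in
  ereal_sup
    [set (\int[P]_w (expeR (r%:E * tau w) *
             (\1_[set w' | (tau w' < theta w')%E \/ theta w' = +oo%E] w)%:E))%E
    | tau in stopping_time G].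

(* Under well-posedness, tau = hitting_time r alpha is the minimal optimizer of
   the problem whose value is stopping_value. *)
Definition well_posed (R : realType) (d : measure_display)
    (Omega : measurableType d) (P : probability Omega R)
    (G : R -> set (set Omega)) (E : Omega -> R) (r : R)
    (alpha : R -> Omega -> R) (tau : Omega -> \bar R) : Prop :=
  {ae P, forall w, (tau w < +oo)%E} /\
  stopping_value P G E r alpha \is a fin_num.

(* For each fixed t the variables (Y^i_t)_i are i.i.d.; joint independence of
   the whole processes is not required. *)
Record n_player_signals (R : realType) (d : measure_display)
    (Omega : measurableType d) (P : probability Omega R)
    (G : R -> set (set Omega)) (F : R -> R -> R)
    (Y : nat -> R -> Omega -> R) : Prop := {
  n_player_signal_process : forall i, signal_process G (Y i) ;
  n_player_signal_cdf : forall t i, 0 <= t -> has_cdf P (Y i t) (F t) ;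
  n_player_signal_independent : forall t, 0 <= t ->
    mutually_independent P (fun i => Y i t) }.

Definition fraction_stopped (R : realType) (d : measure_display)
    (Omega : measurableType d) (n : nat) (tau : 'I_n -> Omega -> \bar R)
    (t : R) (w : Omega) : R :=
  #|[pred j : 'I_n | (tau j w <= t%:E)%E]|%:R / n%:R.

Definition fraction_others_stopped (R : realType) (d : measure_display)
    (Omega : measurableType d) (n : nat) (tau : 'I_n -> Omega -> \bar R)
    (i : 'I_n) (t : R) (w : Omega) : R :=
  #|[pred j : 'I_n | (j != i) && (tau j w <= t%:E)%E]|%:R / n%:R.

(* Player k (1 <= k <= n) is the index k - 1 : 'I_n, with signal Y (k - 1). *)
Definition n_player_equilibrium (R : realType) (d : measure_display)
    (Omega : measurableType d) (P : probability Omega R)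
    (G : R -> set (set Omega)) (E : Omega -> R) (r c : R)
    (Y : nat -> R -> Omega -> R) (n : nat) (rho : R -> Omega -> R) : Prop :=
  adapted G rho /\
  exists tau : 'I_n -> Omega -> \bar R,
    let alpha (i : 'I_n) t w := Y i t w + c * fraction_others_stopped tau i t w in
    [/\ forall i, stopping_time G (tau i),
        forall i w, tau i w = hitting_time r (fun t => alpha i t w),
        forall i, well_posed P G E r (alpha i) (tau i) &
        forall t w, 0 <= t -> rho t w = fraction_stopped tau t w].

Definition atomless (R : realType) (d : measure_display) (T : measurableType d)
    (mu : probability T R) : Prop :=
  forall A, measurable A -> (0 < mu A)%E ->
    exists B, [/\ measurable B, B `<=` A, (0 < mu B)%E & (mu B < mu A)%E].

(* The measures are not assumed complete, so the inner integral, which only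
   makes sense almost everywhere, is an integrable function up to a null set;
   g and h below are such versions. *)
Record fubini_extension (R : realType) (dI d : measure_display)
    (I : measurableType dI) (Omega : measurableType d)
    (lambda : probability I R) (P : probability Omega R)
    (Sigma : set (set (I * Omega)))
    (mu : probability (g_sigma_algebraType Sigma) R) : Prop := {
  fubini_sigma_algebra : sigma_algebra setT Sigma ;
  fubini_product_measurable : (measurable : set (set (I * Omega))) `<=` Sigma ;
  fubini_product_measure : forall A : set (I * Omega), measurable A ->
    mu A = (lambda \x P)%E A ;
  fubini_iterated : forall f : I * Omega -> R,
    mu.-integrable setT (EFin \o f) ->
    [/\ {ae lambda, forall i, P.-integrable setT (fun w => (f (i, w))%:E)},
        {ae P, forall w, lambda.-integrable setT (fun i => (f (i, w))%:E)},
        exists g : I -> R,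
          [/\ lambda.-integrable setT (EFin \o g),
              {ae lambda, forall i, (g i)%:E = (\int[P]_w (f (i, w))%:E)%E} &
              (\int[lambda]_i (g i)%:E = \int[mu]_z (f z)%:E)%E] &
        exists h : Omega -> R,
          [/\ P.-integrable setT (EFin \o h),
              {ae P, forall w, (h w)%:E = (\int[lambda]_i (f (i, w))%:E)%E} &
              (\int[P]_w (h w)%:E = \int[mu]_z (f z)%:E)%E]] }.

Record mean_field_signals (R : realType) (dI d : measure_display)
    (I : measurableType dI) (Omega : measurableType d)
    (lambda : probability I R) (P : probability Omega R)
    (Sigma : set (set (I * Omega))) (G : R -> set (set Omega))
    (F : R -> R -> R) (Y : I -> R -> Omega -> R) : Prop := {
  mean_field_signal_process : forall i, signal_process G (Y i) ;
  mean_field_signal_measurable : forall t, 0 <= t ->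
    measurable_fun [set: g_sigma_algebraType Sigma]
      (fun z : g_sigma_algebraType Sigma => Y z.1 t z.2) ;
  mean_field_signal_cdf : forall t, 0 <= t ->
    {ae lambda, forall i, has_cdf P (Y i t) (F t)} ;
  mean_field_signal_independent : forall t, 0 <= t ->
    {ae lambda, forall i,
      {ae lambda, forall j, independent2 P (Y i t) (Y j t)}} }.

(* Measurability of {i : tau i w <= t} is part of the requirement, since
   lambda is unspecified on nonmeasurable sets; tau i is arbitrary for i in a
   null set. *)
Definition mean_field_equilibrium (R : realType) (dI d : measure_display)
    (I : measurableType dI) (Omega : measurableType d)
    (lambda : probability I R) (P : probability Omega R)
    (G : R -> set (set Omega)) (E : Omega -> R) (r c : R)
    (Y : I -> R -> Omega -> R) (rho : R -> R) : Prop :=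
  (forall t, 0 <= t -> 0 <= rho t <= 1) /\
  exists tau : I -> Omega -> \bar R,
    let alpha (i : I) t w := Y i t w + c * rho t in
    [/\ {ae lambda, forall i, forall w,
          tau i w = hitting_time r (fun t => alpha i t w)},
        {ae lambda, forall i, well_posed P G E r (alpha i) (tau i)} &
        forall t, 0 <= t -> {ae P, forall w,
          measurable [set i | (tau i w <= t%:E)%E] /\
          lambda [set i | (tau i w <= t%:E)%E] = (rho t)%:E}].

Definition strongly_decreasing_transversal (R : realType) (F : R -> R)
    (r c x : R) : Prop :=
  let g := fun u : R => u + F (r - c * u) in
  [/\ 0 <= x <= 1, g x = 1, derivable g x 1 & (g^`())%classic x < 0].

Definition fatou_cvg_in_probability (R : realType) (d : measure_display)
    (Omega : measurableType d) (P : probability Omega R)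
    (rho_ : nat -> R -> Omega -> R) (rho : R -> R) : Prop :=
  exists D : set R,
    [/\ D `<=` `[0, +oo[, `[0, +oo[ `<=` closure D &
        forall t, D t -> forall eps : R, 0 < eps ->
          P [set w | eps < `|rho_ n t w - rho t|] @[n --> \oo] --> 0%E].

(* Main.v *)
Require Import Defs.
From mathcomp Require Import all_boot all_order all_algebra.
From mathcomp Require Import all_classical all_reals all_analysis.
From mathcomp Require Import measurable_realfun.
From mathcomp Require Import zify ring lra.
Import Order.TTheory GRing.Theory Num.Theory.
Import numFieldNormedType.Exports.
Local Open Scope classical_set_scope.
Local Open Scope ring_scope.

(** A single time suffices.  The interior of the transversal set meets the
    dense set of times at which convergence in probability holds; fix such a
    time t and put x = rho t.  For n players let y_j = r - c j / n and let N_j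
    be the number of signals that are at least y_j.  If k players have stopped
    in an equilibrium, each of them sees k - 1 others and each of the remaining
    players sees k, so that k signals are at least y_(k-1) and all the other
    signals are below y_k: N_(k-1) = N_k = k.  In other words the walk N_j - j
    steps from 1 down to 0 at j = k ([equilibrium_downcrossing]).

    Let G_j be the probability that a signal is at least y_j.  Then N_j has
    mean n G_j, and strong decreasing transversality says that G_j grows at a
    rate l > 1 with respect to j / n near x ([tail_expanding]).  The walk thus
    drifts upwards and crosses zero from below to above near j = n x.  The
    theorem follows because, with a probability bounded below uniformly in n,
    it does so without a single step from 1 to 0 in a window around n x
    ([transversal_sample_no_downcrossing]); on that event the fraction of
    stopped players is at a fixed distance from x.

    For the uniform bound the walk is read backwards in j, that is, the signals
    are revealed from the smallest to the largest.  Given what is visible at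
    level k, each of the N_k large signals exceeds y_j (j <= k) with probability
    G_j / G_k, independently, so that (1 + v / G_j)^(N_j) is a martingale for
    each v ([exponential_martingale]).  The rate l > 1 makes (1 + v / G_j)^j
    nonincreasing in j on the window when v is small.  At the first level k,
    going backwards, with N_k <= k, the martingale is at most (1 + v / G_k)^k;
    a downcrossing requires a later level j with N_j > j, where the martingale
    is at least (1 + v / G_j)^(j + 1) >= (1 + v) (1 + v / G_k)^k.  By the
    maximal inequality this has conditional probability at most 1 / (1 + v)
    ([downcrossing_bound]).  Finally such a level k exists with a probability
    bounded below, by the Markov inequality for N_j at the lower end of the
    window, where G_j is smaller than j / n by a fixed amount
    ([no_downcrossing_bound]).

    Only the comparison of the signals with finitely many thresholds matters,
    so the martingale argument is carried out for independent bins in a finite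
    type, where b_i <= j means that signal i is at least y_j. *)

Lemma ler_sum_subpred (R : numDomainType) (T : finType) (P Q : pred T)
    (f : T -> R) :
  (forall x, 0 <= f x) -> (forall x, P x -> Q x) ->
  \sum_(x | P x) f x <= \sum_(x | Q x) f x.
Proof.
move=> f0 PQ; rewrite big_mkcond [leRHS]big_mkcond; apply: ler_sum => x _.
by case: ifP => [/PQ ->//|_]; case: ifP.
Qed.

(** * Independent bins: a maximal inequality for counts *)

Section Bins.
Variables (R : realType) (n K : nat).
Variables (p : 'I_n -> 'I_K.+1 -> R) (G : nat -> R).
Hypothesis p_ge0 : forall i l, 0 <= p i l.
Hypothesis pG : forall i j, (j <= K)%N ->
  \sum_(l : 'I_K.+1 | (l <= j)%N) p i l = G j.
Hypothesis GK : G K = 1.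

Definition weight (b : {ffun 'I_n -> 'I_K.+1}) : R := \prod_i p i (b i).

Definition count_upto (b : {ffun 'I_n -> 'I_K.+1}) (j : nat) : nat :=
  #|[pred i | (b i <= j)%N]|.

(** The events that are visible once all bins above k are revealed while the
    bins up to k are merged.  The smaller k is, the more is visible: this is the
    filtration of the backward walk. *)
Definition known_from (k : nat) (H : pred {ffun 'I_n -> 'I_K.+1}) : Prop :=
  forall b b' : {ffun 'I_n -> 'I_K.+1},
    (forall i, maxn (b i) k = maxn (b' i) k) -> H b = H b'.

(** A step from 1 to 0 of the walk [count_upto b j - j]. *)
Definition downcrossing (k1 k2 : nat) (b : {ffun 'I_n -> 'I_K.+1}) : bool :=
  [exists j : 'I_K.+1, [&& (k1 < j <= k2)%N, count_upto b j == j
                         & count_upto b j.-1 == j]].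

Lemma weight_ge0 b : 0 <= weight b.
Proof. by apply: prodr_ge0 => i _. Qed.

Lemma count_upto_eq (b b' : {ffun 'I_n -> 'I_K.+1}) (j k : nat) : (k <= j)%N ->
  (forall i, maxn (b i) k = maxn (b' i) k) -> count_upto b j = count_upto b' j.
Proof.
move=> kj bb'; apply: eq_card => i; rewrite !inE.
by have := bb' i; lia.
Qed.

Lemma known_from_count k j (Q : pred nat) : (k <= j)%N ->
  known_from k (fun b => Q (count_upto b j)).
Proof. by move=> kj b b' bb'; rewrite (count_upto_eq _ _ _ _ kj bb'). Qed.

Lemma known_from_and k H H' : known_from k H -> known_from k H' ->
  known_from k (fun b => H b && H' b).
Proof. by move=> h h' b b' bb'; rewrite (h _ _ bb') (h' _ _ bb'). Qed.

Lemma known_from_le j k H : (j <= k)%N -> known_from k H -> known_from j H.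
Proof.
move=> jk h b b' bb'; apply: h => i; have := bb' i; lia.
Qed.

(** The mass of a merged bin under the tilted weights.  Tilting by
    1 + v / G j on the bins up to j adds v to the total mass of the bins up to
    k, whatever the value of j <= k; this is why the tilted product below is a
    martingale. *)
Lemma tilted_truncation (v : R) (j k : nat) (i : 'I_n) (m : 'I_K.+1) :
  (j <= k)%N -> (k <= K)%N -> G j != 0 ->
  \sum_(l : 'I_K.+1 | inord (maxn l k) == m)
     p i l * (if (l <= j)%N then 1 + v / G j else 1) =
  if (m < k)%N then 0 else if (k < m)%N then p i m else G k + v.
Proof.
move=> jk kK Gj0.
have E (l : 'I_K.+1) : (inord (maxn l k) == m) = (maxn l k == m).
  by rewrite -val_eqE /= inordK //; have := ltn_ord l; lia.
under eq_bigl do rewrite E.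
case: ltnP => mk.
  by rewrite big_pred0 // => l; lia.
case: ltnP => km.
  rewrite (big_pred1 m) => [|l]; last by rewrite /= -val_eqE /=; lia.
  by rewrite leqNgt (leq_ltn_trans jk km) /= mulr1.
have -> : \sum_(l : 'I_K.+1 | maxn l k == m)
     p i l * (if (l <= j)%N then 1 + v / G j else 1) =
   \sum_(l : 'I_K.+1 | (l <= k)%N)
     (p i l + (if (l <= j)%N then p i l * (v / G j) else 0)).
  apply: eq_big => [l|l _]; first by lia.
  by case: ifP => _; rewrite ?mulr1 ?addr0 // mulrDr mulr1.
rewrite big_split /= pG // -big_mkcondr /=.
have -> : \sum_(l : 'I_K.+1 | (l <= k)%N && (l <= j)%N) p i l * (v / G j) = v.
  rewrite (eq_bigl (fun l : 'I_K.+1 => (l <= j)%N)); last by move=> l; lia.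
  rewrite -mulr_suml pG; last by lia.
  by rewrite mulrCA divff // mulr1.
by [].
Qed.

(** Summing over the configurations with given truncations at k factorizes over
    the players, and [tilted_truncation] shows that each factor is the same for
    j and for k. *)
Lemma exponential_martingale (v : R) (H : pred {ffun 'I_n -> 'I_K.+1})
    (j k : nat) :
  (j <= k)%N -> (k <= K)%N -> G j != 0 -> G k != 0 -> known_from k H ->
  \sum_(b | H b) weight b * (1 + v / G j) ^+ count_upto b j =
  \sum_(b | H b) weight b * (1 + v / G k) ^+ count_upto b k.
Proof.
move=> jk kK Gj0 Gk0 Hk.
pose trunc (b : {ffun 'I_n -> 'I_K.+1}) : {ffun 'I_n -> 'I_K.+1} :=
  [ffun i => inord (maxn (b i) k)].
have truncE b i : trunc b i = maxn (b i) k :> nat.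
  by rewrite ffunE inordK //; have := ltn_ord (b i); lia.
have Htrunc b : H (trunc b) = H b.
  by apply: Hk => i; rewrite truncE; lia.
suff closed l : (l <= k)%N -> G l != 0 ->
    \sum_(b | H b) weight b * (1 + v / G l) ^+ count_upto b l =
    \sum_(t | H t) \prod_i
      (if (t i < k)%N then 0 else if (k < t i)%N then p i (t i) else G k + v).
  by rewrite closed // closed.
move=> lk Gl0; rewrite (partition_big trunc H) /=; last first.
  by move=> b; rewrite Htrunc.
apply: eq_bigr => t Ht.
under [RHS]eq_bigr => i _ do rewrite -(tilted_truncation v l k i (t i) lk kK Gl0).
rewrite bigA_distr_big_dep; apply: eq_big => [b|b _].
  apply/andP/familyP => [[_ /eqP <-] i|bt]; first by rewrite unfold_in /= ffunE.
  have E : trunc b = t by apply/ffunP => i; have /eqP := bt i; rewrite ffunE.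
  by rewrite -Htrunc E eqxx Ht.
rewrite big_split /=; congr (_ * _).
by rewrite -big_mkcond /= prodr_const.
Qed.

(** Optional stopping at the largest index j < k with [j < count_upto b j]: the
    martingale is at least D there.  The induction on k peels off the index
    k - 1, the first one met by the backward walk. *)
Lemma ville_inequality (v D : R) (k1 k : nat) (H : pred {ffun 'I_n -> 'I_K.+1}) :
  0 <= v -> (k1 <= k <= K)%N ->
  (forall j, (k1 <= j <= k)%N -> 0 < G j) ->
  (forall j, (k1 <= j < k)%N -> D <= (1 + v / G j) ^+ j.+1) ->
  known_from k H ->
  \sum_(b | H b && has (fun j => (j < count_upto b j)%N) (index_iota k1 k))
     weight b * D
  <= \sum_(b | H b) weight b * (1 + v / G k) ^+ count_upto b k.
Proof.
move=> v0 /andP[]; elim: k H => [|k IH] H k1k kK Gpos Dle Hk.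
  rewrite big_pred0 => [|b]; last by rewrite andbF.
  apply: sumr_ge0 => b _; rewrite mulr_ge0 ?weight_ge0 // exprn_ge0 //.
  by rewrite addr_ge0 // divr_ge0 // ltW // Gpos // k1k leqnn.
have tilt_ge1 j : (k1 <= j <= k.+1)%N -> 1 <= 1 + v / G j.
  by move=> jk; rewrite lerDl divr_ge0 // ltW // Gpos.
move: k1k; rewrite leq_eqVlt => /predU1P[k1E|k1k].
  rewrite big_pred0 => [|b]; last by rewrite k1E /index_iota subnn andbF.
  apply: sumr_ge0 => b _; rewrite mulr_ge0 ?weight_ge0 // exprn_ge0 //.
  by rewrite (le_trans ler01) // tilt_ge1 // k1E leqnn.
rewrite ltnS in k1k.
have Gk : G k != 0 by rewrite gt_eqF // Gpos //; lia.
have GSk : G k.+1 != 0 by rewrite gt_eqF // Gpos //; lia.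
rewrite -(exponential_martingale v H k k.+1) //.
have has_rec b : has (fun j => (j < count_upto b j)%N) (index_iota k1 k.+1) =
    has (fun j => (j < count_upto b j)%N) (index_iota k1 k)
    || (k < count_upto b k)%N.
  by rewrite /index_iota subSn // -addn1 iotaD has_cat /= subnKC // orbF.
rewrite (bigID (fun b => (k < count_upto b k)%N)) /=.
rewrite [leRHS](bigID (fun b => (k < count_upto b k)%N)) /=.
apply: lerD.
  rewrite (eq_bigl (fun b => H b && (k < count_upto b k)%N)); last first.
    by move=> b; rewrite has_rec; case: (k < _)%N; rewrite ?andbF // orbT andbT.
  apply: ler_sum => b /andP[_ kb]; apply: ler_wpM2l; first exact: weight_ge0.
  apply: (le_trans (Dle k _)); first by rewrite k1k ltnSn.
  by apply: ler_weXn2l => //; apply: tilt_ge1; lia.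
rewrite (eq_bigl (fun b => (H b && ~~ (k < count_upto b k)%N) &&
    has (fun j => (j < count_upto b j)%N) (index_iota k1 k))); last first.
  move=> b; rewrite has_rec; case: (k < _)%N; rewrite ?andbF //=.
  by rewrite orbF !andbT.
apply: IH => //; first by lia.
- by move=> j jk; apply: Gpos; lia.
- by move=> j jk; apply: Dle; lia.
- apply: known_from_and; first by apply: (known_from_le k _ _ (leqnSn k)).
  by apply: (known_from_count k k (fun m => ~~ (k < m)%N)).
Qed.

(** Restarting the martingale at the first index, going backwards from k2, at
    which the count is at most the index: a downcrossing of the window forces
    the count to exceed its index again further down, and the second hypothesis
    on G keeps the value (1 + v / G j) ^+ j required there above the one at the
    restart.  The event H carries the information collected before the restart
    through the induction on k2. *)
Lemma downcrossing_bound (v : R) (k1 k2 : nat)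
    (H : pred {ffun 'I_n -> 'I_K.+1}) :
  0 <= v -> (k1 <= k2 <= K)%N ->
  (forall j, (k1 <= j <= k2)%N -> 0 < G j <= 1) ->
  (forall j, (k1 <= j < k2)%N ->
     (1 + v / G j.+1) ^+ j.+1 <= (1 + v / G j) ^+ j) ->
  known_from k2 H ->
  (1 + v) * \sum_(b | [&& H b,
      has (fun j => (count_upto b j <= j)%N) (index_iota k1 k2.+1)
      & downcrossing k1 k2 b]) weight b
  <= \sum_(b | H b &&
      has (fun j => (count_upto b j <= j)%N) (index_iota k1 k2.+1)) weight b.
Proof.
move=> v0 /andP[]; elim: k2 H => [|k IH] H k1k kK Gpos Cle Hk.
  rewrite [X in _ * X]big_pred0 => [|b]; last first.
    apply/negbTE/negP => /and3P[_ _ /existsP[j]]; lia.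
  by rewrite mulr0; apply: sumr_ge0 => b _; exact: weight_ge0.
move: k1k; rewrite leq_eqVlt => /predU1P[k1E|k1k].
  rewrite [X in _ * X]big_pred0 => [|b]; last first.
    apply/negbTE/negP => /and3P[_ _ /existsP[j]]; lia.
  by rewrite mulr0; apply: sumr_ge0 => b _; exact: weight_ge0.
rewrite ltnS in k1k.
have Gpos' j : (k1 <= j <= k.+1)%N -> 0 < G j by move=> /Gpos /andP[].
have C_ge j : (k1 <= j <= k.+1)%N ->
    (1 + v / G k.+1) ^+ k.+1 <= (1 + v / G j) ^+ j.
  move=> /andP[k1j jk].
  rewrite -(subnKC jk); move: (k.+1 - j)%N (subnKC jk) => m.
  elim: m j k1j jk => [|m IHm] j k1j jk; first by rewrite addn0.
  move=> E; rewrite -addSnnS; apply: le_trans (IHm j.+1 _ _ _) _; try lia.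
  by apply: Cle; lia.
set C := (1 + v / G k.+1) ^+ k.+1 in C_ge.
have tilt_gt0 j : (k1 <= j <= k.+1)%N -> 1 <= 1 + v / G j.
  by move=> jk; rewrite lerDl divr_ge0 // ltW // Gpos'.
have C0 : 0 < C.
  by rewrite exprn_gt0 // (lt_le_trans ltr01) // tilt_gt0 //; lia.
have has_rec b : has (fun j => (count_upto b j <= j)%N) (index_iota k1 k.+2) =
    has (fun j => (count_upto b j <= j)%N) (index_iota k1 k.+1)
    || (count_upto b k.+1 <= k.+1)%N.
  rewrite /index_iota subSn ?(leqW k1k) // -addn1 iotaD has_cat /=.
  by rewrite subnKC ?(leqW k1k) // orbF.
(* If the count at k + 1 is at most k + 1, the restart happens here and Ville's
   inequality applies; otherwise no downcrossing ends at k + 1, and the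
   induction hypothesis applies with this event added to H. *)
rewrite (bigID (fun b => (count_upto b k.+1 <= k.+1)%N)) /=.
rewrite [leRHS](bigID (fun b => (count_upto b k.+1 <= k.+1)%N)) /= mulrDr.
apply: lerD.
  rewrite [leRHS](eq_bigl
    (fun b => H b && (count_upto b k.+1 <= k.+1)%N)); last first.
    by move=> b; rewrite has_rec; case: (_ <= k.+1)%N; rewrite ?andbF // orbT andbT.
  pose H' b := H b && (count_upto b k.+1 <= k.+1)%N.
  have H'k : known_from k.+1 H'.
    by apply: known_from_and => //; apply: (known_from_count _ _ (leq^~ k.+1)).
  have := ville_inequality v ((1 + v) * C) k1 k.+1 H' v0.
  move=> /(_ _ Gpos' _ H'k) V.
  rewrite -(ler_pM2r C0).
  apply: (@le_trans _ _ (\sum_(b | H' b && has (fun j => (j < count_upto b j)%N)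
     (index_iota k1 k.+1)) weight b * ((1 + v) * C))).
    rewrite -mulr_suml mulrAC [leRHS]mulrC; apply: ler_wpM2l.
      by rewrite mulr_ge0 ?addr_ge0 // ltW.
    apply: ler_sum_subpred => [b|b]; first exact: weight_ge0.
    move=> /andP[/and3P[Hb _ /existsP[j /and3P[jk cj cj1]]] bk].
    rewrite /H' Hb bk /=; apply/hasP; exists j.-1; rewrite ?mem_index_iota; lia.
  apply: le_trans (V _ _) _.
  - lia.
  - move=> j jk; rewrite exprS; apply: ler_pM => //.
    + lra.
    + exact: ltW.
    + have /andP[Gj0 Gj1] : 0 < G j <= 1 by apply: Gpos; lia.
      by rewrite lerD2l ler_pdivlMr // ler_piMr.
    + by apply: C_ge; lia.
  rewrite mulr_suml; apply: ler_sum => b /andP[_ bk].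
  apply: ler_wpM2l; first exact: weight_ge0.
  by apply: ler_weXn2l => //; apply: tilt_gt0; lia.
rewrite (eq_bigl (fun b => [&& H b && ~~ (count_upto b k.+1 <= k.+1)%N,
      has (fun j => (count_upto b j <= j)%N) (index_iota k1 k.+1)
      & downcrossing k1 k b])); last first.
  move=> b; rewrite has_rec; case: leqP => bk; first by rewrite !andbF.
  rewrite orbF andbT /=; congr [&& _, _ & _].
    by rewrite andbT.
  apply/existsP/existsP => -[j jk]; exists j; last by lia.
  have : (j != k.+1 :> nat) by apply/eqP => jE; move: jk; rewrite jE; lia.
  lia.
rewrite [leRHS](eq_bigl (fun b => (H b && ~~ (count_upto b k.+1 <= k.+1)%N) &&
      has (fun j => (count_upto b j <= j)%N) (index_iota k1 k.+1))); last first.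
  move=> b; rewrite has_rec; case: (_ <= k.+1)%N; rewrite ?andbF //=.
  by rewrite orbF !andbT.
apply: IH => //; first by lia.
- by move=> j jk; apply: Gpos; lia.
- by move=> j jk; apply: Cle; lia.
- apply: known_from_and; first by apply: (known_from_le k _ _ (leqnSn k)).
  by apply: (known_from_count k k.+1 (fun m => ~~ (m <= k.+1)%N)).
Qed.

Lemma weight_sum : \sum_b weight b = 1.
Proof.
rewrite /weight -bigA_distr_bigA big1 // => i _.
by rewrite -[RHS]GK -(pG i K) //; apply: eq_bigl => l; rewrite -ltnS ltn_ord.
Qed.

Lemma count_upto_expectation (k : nat) : (k <= K)%N ->
  \sum_b weight b * (count_upto b k)%:R = n%:R * G k.
Proof.
move=> kK.
have countE b : (count_upto b k)%:R = \sum_i ((b i <= k)%N)%:R :> R.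
  by rewrite /count_upto -sum1_card natr_sum [LHS]big_mkcond /=;
    apply: eq_bigr => i _; rewrite inE; case: ifP.
under eq_bigr do rewrite countE mulr_sumr.
rewrite exchange_big /= (eq_bigr (fun=> G k)).
  by rewrite sumr_const card_ord mulr_natl.
move=> i _.
pose F i' l := p i' l * (if i' == i then ((l <= k)%N)%:R else 1).
transitivity (\sum_(b : {ffun 'I_n -> 'I_K.+1}) \prod_i' F i' (b i')).
  apply: eq_bigr => b _; rewrite big_split /=; congr (_ * _).
  by rewrite -big_mkcond big_pred1_eq.
rewrite -bigA_distr_bigA (bigD1 i) //= [X in _ * X]big1 ?mulr1 => [|i' i'i].
  rewrite -(pG i k) // big_mkcond [RHS]big_mkcond; apply: eq_bigr => l _.
  by rewrite /F eqxx; case: (l <= k)%N; rewrite ?mulr1 ?mulr0.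
rewrite -[RHS]GK -(pG i' K) //; apply: eq_big => [l|l _].
  by rewrite -ltnS ltn_ord.
by rewrite /F (negbTE i'i) mulr1.
Qed.

Lemma count_upto_markov (k : nat) : (k <= K)%N ->
  1 - n%:R * G k / k.+1%:R <= \sum_(b | (count_upto b k <= k)%N) weight b.
Proof.
move=> kK; rewrite lerBlDr -[leLHS]weight_sum.
rewrite (bigID (fun b => (count_upto b k <= k)%N)) /= lerD2l.
rewrite ler_pdivlMr ?ltr0Sn // -count_upto_expectation // mulr_suml.
rewrite [leRHS](bigID (fun b => (count_upto b k <= k)%N)) /=.
rewrite -[leLHS]add0r; apply: lerD.
  by apply: sumr_ge0 => b _; rewrite mulr_ge0 ?weight_ge0.
apply: ler_sum => b bk; apply: ler_wpM2l; first exact: weight_ge0.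
by rewrite ler_nat ltnNge.
Qed.

(** The hypothesis on the increments of G is the discrete form of a growth rate
    above 1; Bernoulli's inequality turns it into the monotonicity of
    (1 + v / G j) ^+ j.  The last factor bounds from below the probability that
    the count at k1 is at most k1. *)
Lemma no_downcrossing_bound (v : R) (k1 k2 : nat) :
  0 <= v -> (k1 <= k2 <= K)%N ->
  (forall j, (k1 <= j <= k2)%N -> 0 < G j <= 1) ->
  (forall j, (k1 <= j < k2)%N ->
     G j <= G j.+1 /\ G j.+1 + v <= j%:R * (G j.+1 - G j)) ->
  v / (1 + v) * (1 - n%:R * G k1 / k1.+1%:R)
  <= \sum_(b | ~~ downcrossing k1 k2 b) weight b.
Proof.
move=> v0 k12 G01 Ginc.
have Cle j : (k1 <= j < k2)%N -> (1 + v / G j.+1) ^+ j.+1 <= (1 + v / G j) ^+ j.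
  move=> jk.
  have /andP[Gj0 _] : 0 < G j <= 1 by apply: G01; lia.
  have /andP[GSj0 _] : 0 < G j.+1 <= 1 by apply: G01; lia.
  have [Gle Gincj] := Ginc j jk.
  pose q := (1 + v / G j) / (1 + v / G j.+1).
  have tilt0 : 0 < 1 + v / G j.+1 by rewrite ltr_wpDr // divr_ge0 // ltW.
  have qE : q = 1 + v * (G j.+1 - G j) / (G j * (G j.+1 + v)).
    rewrite /q; field; rewrite !gt_eqF //=; try lra.
  have bern m (y : R) : 0 <= y -> 1 + m%:R * y <= (1 + y) ^+ m.
    move=> y0; elim: m => [|m IHm]; first by rewrite mul0r addr0.
    rewrite exprS; apply: le_trans (ler_wpM2l _ IHm); last by lra.
    rewrite -natr1; have : 0 <= m%:R :> R by []. nra.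
  have : 1 + v / G j.+1 <= q ^+ j.
    have y0 : 0 <= v * (G j.+1 - G j) / (G j * (G j.+1 + v)).
      by rewrite divr_ge0 ?mulr_ge0 ?subr_ge0 ?addr_ge0 // ltW.
    rewrite qE; apply: le_trans (bern j _ y0).
    rewrite lerD2l mulrA ler_pdivlMr; last by rewrite mulr_gt0 // ltr_wpDr.
    rewrite mulrAC ler_pdivrMr //.
    rewrite [leRHS](_ : _ = v * (G j.+1 * (j%:R * (G j.+1 - G j)))); last by ring.
    apply: ler_wpM2l => //; apply: ler_pM => //; first exact: ltW.
    by rewrite addr_ge0 // ltW.
  by rewrite expr_div_n ler_pdivlMr ?exprn_gt0 // -exprS.
have := downcrossing_bound v k1 k2 predT v0 k12 G01 Cle.
move=> /(_ (fun _ _ _ => erefl)) /=.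
pose E (b : {ffun 'I_n -> 'I_K.+1}) :=
  has (fun j => (count_upto b j <= j)%N) (index_iota k1 k2.+1).
rewrite -/E => B.
have EA : \sum_(b | E b) weight b = \sum_(b | E b && downcrossing k1 k2 b) weight b
    + \sum_(b | E b && ~~ downcrossing k1 k2 b) weight b by rewrite -bigID.
have EM := count_upto_markov k1 ltac:(lia).
have ME : \sum_(b | (count_upto b k1 <= k1)%N) weight b <= \sum_(b | E b) weight b.
  apply: ler_sum_subpred => [b|b bk]; first exact: weight_ge0.
  by apply/hasP; exists k1; rewrite // mem_index_iota; lia.
have NE : \sum_(b | E b && ~~ downcrossing k1 k2 b) weight b <=
    \sum_(b | ~~ downcrossing k1 k2 b) weight b.
  by apply: ler_sum_subpred => [b|b /andP[]//]; exact: weight_ge0.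
apply: le_trans NE.
rewrite mulrAC ler_pdivrMr; last by lra.
apply: (@le_trans _ _ (v * \sum_(b | E b) weight b)).
  by apply: ler_wpM2l => //; exact: le_trans ME.
by rewrite EA in B *; lra.
Qed.
End Bins.

(** * From an independent sample to bins *)

Lemma probability_fibers (R : realType) (d : measure_display)
    (Omega : measurableType d) (P : probability Omega R) (T : finType)
    (phi : Omega -> T) :
  (forall t, measurable (phi @^-1` [set t])) ->
  forall Q : pred T, measurable [set w | Q (phi w)] /\
    P [set w | Q (phi w)] = (\sum_(t | Q t) P (phi @^-1` [set t]))%E.
Proof.
move=> mphi Q.
have -> : [set w | Q (phi w)] = \bigcup_(t in [set` Q]) (phi @^-1` [set t]).
  apply/seteqP; split => [w Qw|w [t Qt /= ->]//]; first by exists (phi w).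
have finQ : finite_set [set` Q] by exact: finite_finset.
split; first by apply: fin_bigcup_measurable => // t _; exact: mphi.
rewrite measure_fin_bigcup //.
  by rewrite -(bigfs _ (index_enum_uniq T)) // => t _; rewrite mem_index_enum.
by move=> s t _ _ [w [/= <- <-]].
Qed.

(** [no_downcrossing_bound] for the bins cut out by decreasing thresholds.  The
    conclusion is stated with a measurable event A, since it will be compared
    with the event that the fraction of stopped players is far from its limit. *)
Lemma sample_no_downcrossing (R : realType) (d : measure_display)
    (Omega : measurableType d) (P : probability Omega R)
    (X : nat -> Omega -> R) (y G : nat -> R) (v : R) (n k1 k2 : nat) :
  (forall i, measurable_fun [set: Omega] (X i)) ->
  mutually_independent P X ->
  (forall j l, (j <= l)%N -> y l <= y j) ->
  (forall i j, P [set w | y j <= X i w] = (G j)%:E) ->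
  0 <= v -> (k1 <= k2)%N ->
  (forall j, (k1 <= j <= k2)%N -> 0 < G j) ->
  (forall j, (k1 <= j < k2)%N -> G j.+1 + v <= j%:R * (G j.+1 - G j)) ->
  exists A : set Omega, [/\ measurable A,
    forall w, A w -> forall j, (k1 < j <= k2)%N ->
      #|[pred i : 'I_n | y j <= X i w]| = j ->
      #|[pred i : 'I_n | y j.-1 <= X i w]| = j -> False &
    ((v / (1 + v) * (1 - n%:R * G k1 / k1.+1%:R))%:E <= P A)%E].
Proof.
move=> mX indX ymono PG v0 k12 Gpos Ginc.
pose K := k2.+1.
(* The bin of x is the first threshold index that x reaches, and K for a value
   below all thresholds. *)
pose bin (x : R) : 'I_K.+1 := inord (find (fun j => y j <= x) (iota 0 K)).
have binE x : bin x = find (fun j => y j <= x) (iota 0 K) :> nat.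
  by rewrite inordK // ltnS -[leqRHS](size_iota 0) find_size.
have bin_le x j : (j < K)%N -> (bin x <= j)%N = (y j <= x).
  move=> jK; rewrite binE; apply/idP/idP => [fj|yj].
    have hasf : has (fun j => y j <= x) (iota 0 K).
      by rewrite has_find size_iota; lia.
    have := nth_find 0%N hasf; rewrite nth_iota; last by lia.
    by apply: le_trans; exact: ymono.
  rewrite leqNgt; apply/negP => jf; have := before_find 0%N jf.
  by rewrite nth_iota //= yj.
have m_ge j : measurable [set x : R | y j <= x].
  by rewrite -set_itvcy; exact: measurable_itv.
have m_X_ge i j : measurable [set w | y j <= X i w].
  by have := mX i measurableT _ (m_ge j); rewrite setTI.
have m_bin_le j : measurable [set x : R | (bin x <= j)%N].
  have [jK|Kj] := ltnP j K.
    by under eq_set do rewrite (bin_le _ _ jK).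
  rewrite [X in measurable X](_ : _ = setT) //; apply/seteqP; split => // x _ /=.
  by have := ltn_ord (bin x); lia.
have m_bin_lt j : measurable [set x : R | (bin x < j)%N].
  case: j => [|j]; last exact: m_bin_le.
  by rewrite [X in measurable X](_ : _ = set0) //; apply/seteqP; split.
have m_bin (l : 'I_K.+1) : measurable (bin @^-1` [set l]).
  rewrite [X in measurable X](_ : _ = [set x : R | (bin x <= l)%N] `\`
     [set x : R | (bin x < l)%N]).
    by apply: measurableD => //; exact: m_bin_lt.
  apply/seteqP; split => x /=; first by move=> ->; rewrite leqnn ltnn.
  by move=> [xl /negP xl1]; apply/val_inj => /=; lia.
have m_bin_X i (l : 'I_K.+1) : measurable ((bin \o X i) @^-1` [set l]).
  by have := mX i measurableT _ (m_bin l); rewrite setTI.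
pose p (i : 'I_n) (l : 'I_K.+1) : R := fine (P ((bin \o X i) @^-1` [set l])).
(* The last bin K collects all remaining values, so the cumulative mass there is 1. *)
pose G' j := if (j < K)%N then G j else 1.
have pE i l : P ((bin \o X i) @^-1` [set l]) =
    (fine (P ((bin \o X i) @^-1` [set l])))%:E.
  by rewrite fineK // fin_num_measure.
have p0 i l : 0 <= p i l by rewrite fine_ge0.
have pG i j : (j <= K)%N ->
    \sum_(l : 'I_K.+1 | (l <= j)%N) p i l = G' j.
  move=> jK; apply: EFin_inj; rewrite -sumEFin.
  under eq_bigr do rewrite -pE.
  have [_ <-] := probability_fibers _ _ _ P _ _ (m_bin_X i)
    (fun l : 'I_K.+1 => (l <= j)%N).
  rewrite /G'; case: ltnP => jK'.
    by rewrite -(PG i); congr (P _); apply/seteqP; split => w /=;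
      rewrite bin_le.
  rewrite -(@probability_setT _ _ _ P); congr (P _).
  by apply/seteqP; split => // w _ /=; have := ltn_ord (bin (X i w)); lia.
pose phi w : {ffun 'I_n -> 'I_K.+1} := [ffun i : 'I_n => bin (X i w)].
pose S (b : {ffun 'I_n -> 'I_K.+1}) (i : nat) : set R :=
  if insub i is Some i' then bin @^-1` [set b i'] else setT.
have mS b i : measurable (S b i) by rewrite /S; case: insub.
have phiE b : phi @^-1` [set b] = \bigcap_(i in [set` iota 0 n]) X i @^-1` S b i.
  apply/seteqP; split => w /=.
    move=> <- i; rewrite /= mem_iota /= => lt_in.
    by rewrite /S insubT /= ffunE.
  move=> Sw; apply/ffunP => i; rewrite ffunE.
  by have := Sw i; rewrite /= mem_iota /= ltn_ord /S valK; apply.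
have m_phi b : measurable (phi @^-1` [set b]).
  rewrite phiE; apply: fin_bigcap_measurable => // i _.
  by have := mX i measurableT _ (mS b i); rewrite setTI.
have P_phi b : P (phi @^-1` [set b]) = (weight R n K p b)%:E.
  rewrite phiE indX ?iota_uniq // -[iota 0 n](_ : index_iota 0 n = _); last first.
    by rewrite /index_iota subn0.
  rewrite big_mkord /weight -prodEFin; apply: eq_bigr => i _.
  by rewrite /S valK -pE.
have [mA PA] := probability_fibers _ _ _ P _ _ m_phi
  (fun b => ~~ downcrossing n K k1 k2 b).
have countE w j : (j < K)%N ->
    count_upto n K (phi w) j = #|[pred i : 'I_n | y j <= X i w]|.
  by move=> jK; apply: eq_card => i; rewrite !inE ffunE bin_le.
eexists; split; first exact: mA.
  move=> w /= /negP nd j jk Nj Nj1; apply: nd; apply/existsP.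
  exists (inord j); rewrite !inordK; try by rewrite /K; lia.
  by rewrite !countE ?Nj ?Nj1 ?eqxx ?andbT //; rewrite /K; lia.
rewrite PA; under eq_bigr do rewrite P_phi.
rewrite sumEFin lee_fin.
have -> : G k1 = G' k1 by rewrite /G' ifT // /K; lia.
apply: no_downcrossing_bound => //.
- by rewrite /G' ltnn.
- by rewrite /K; lia.
- move=> j jk; rewrite /G' ifT; last by rewrite /K; lia.
  by rewrite Gpos //= -lee_fin -(PG 0%N) probability_le1 // m_X_ge.
- move=> j jk; rewrite /G' !ifT; try by rewrite /K; lia.
  split; last exact: Ginc.
  rewrite -lee_fin -!(PG 0%N) le_measure ?inE ?m_X_ge // => w /=.
  exact: le_trans (ymono _ _ (leqnSn j)).
Qed.

(** * Equilibria as downcrossings *)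

(** Right continuity makes the infimum attained. *)
Lemma hitting_time_le (R : realType) (r : R) (a : R -> R) (t : R) :
  0 <= t -> (forall s u, 0 <= s -> s <= u -> a s <= a u) ->
  a s @[s --> t^'+] --> a t ->
  (hitting_time r a <= t%:E)%E = (r <= a t).
Proof.
move=> t0 amono acont; apply/idP/idP => [le_t|rt]; last first.
  by apply: ereal_inf_lbound; exists t.
rewrite leNgt; apply/negP => lt_r.
have : \forall s \near t^'+, a s < r by exact: cvgr_lt acont _ lt_r.
move=> /(filterI (nbhs_right_gt t)) /filter_ex [s /= [ts asr]].
have : (hitting_time r a < s%:E)%E by apply: le_lt_trans le_t _; rewrite lte_fin.
move=> /ereal_inf_lt [_ [u [u0 ru] <-]]; rewrite lte_fin => /ltW us.
by have := le_trans ru (amono _ _ u0 us); rewrite leNgt asr.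
Qed.

Lemma stopped_count_right_constant (R : realType) (n : nat)
    (tau : 'I_n -> \bar R) (Q : pred 'I_n) (t : R) :
  \forall s \near t^'+,
    #|[pred j | Q j && (tau j <= s%:E)%E]| =
    #|[pred j | Q j && (tau j <= t%:E)%E]|.
Proof.
have H (j : 'I_n) : \forall s \near t^'+, (tau j <= s%:E)%E = (tau j <= t%:E)%E.
  have [jt|tj] := leP (tau j) t%:E.
    apply: filterS (nbhs_right_gt t) => s ts.
    by apply: le_trans jt _; rewrite lee_fin ltW.
  case: (tau j) tj => [u| |] //=; last by move=> _; exact: nearW.
  rewrite lte_fin => tu; apply: filterS (nbhs_right_lt tu) => s su.
  by apply/negbTE; rewrite lee_fin -ltNge.
have : \forall s \near t^'+, forall j, (tau j <= s%:E)%E = (tau j <= t%:E)%E.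
  by apply: filter_forall.
apply: filterS => s Hs.
by apply: eq_card => j; rewrite !inE Hs.
Qed.

(** A stopped player is compared with the threshold of k - 1 others and a player
    who has not stopped with the lower threshold of k others, so no signal lies
    between the two. *)
Lemma equilibrium_downcrossing (R : realType) (d : measure_display)
    (Omega : measurableType d) (P : probability Omega R)
    (G : R -> set (set Omega)) (E : Omega -> R) (r c : R)
    (Y : nat -> R -> Omega -> R) (n : nat) (rho : R -> Omega -> R)
    (t : R) (w : Omega) :
  (0 < n)%N -> 0 < c -> 0 <= t -> (forall i, signal_process G (Y i)) ->
  n_player_equilibrium P G E r c Y n rho ->
  exists k : nat, [/\ rho t w = k%:R / n%:R,
    #|[pred i : 'I_n | r - c * (k%:R / n%:R) <= Y i t w]| = k &
    (0 < k)%N -> #|[pred i : 'I_n | r - c * (k.-1%:R / n%:R) <= Y i t w]| = k].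
Proof.
move=> n0 c0 t0 hY [_ [tau [_ tauE _ rhoE]]].
pose stopped := [pred j : 'I_n | (tau j w <= t%:E)%E].
pose others i s : nat := #|[pred j : 'I_n | (j != i) && (tau j w <= s%:E)%E]|.
have n0' : 0 < n%:R :> R by rewrite ltr0n.
have stoppedE i : (tau i w <= t%:E)%E = (r <= Y i t w + c * ((others i t)%:R / n%:R)).
  rewrite tauE; apply: hitting_time_le => //.
    move=> s u s0 su; apply: lerD; first exact: signal_increasing (hY i) _ _ _ s0 su.
    rewrite ler_pM2l // ler_pM2r ?invr_gt0 // ler_nat; apply: subset_leq_card.
    apply/fintype.subsetP => j; rewrite !inE => /andP[-> /le_trans]; apply.
    by rewrite lee_fin.
  apply: cvgD; first exact: signal_right_continuous.
  apply: cvg_near_cst.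
  apply: filterS (stopped_count_right_constant _ _ (fun j => tau j w) (predC1 i) t).
  by move=> s E'; rewrite /fraction_others_stopped E'.
pose k := #|stopped|.
have othersE i : others i t = if (tau i w <= t%:E)%E then k.-1 else k.
  rewrite /others /k (cardD1 i stopped) inE.
  have -> : #|[predD1 stopped & i]| = #|[pred j | (j != i) && (tau j w <= t%:E)%E]|.
    by apply: eq_card.
  by case: (_ <= _)%E; rewrite ?add1n ?add0n.
have dec m : r - c * (m%:R / n%:R) <= r - c * (m.-1%:R / n%:R).
  rewrite lerD2l lerN2 ler_pM2l // ler_pM2r ?invr_gt0 // ler_nat; lia.
exists k; split; first by rewrite rhoE.
  apply: eq_card => i; rewrite !inE; apply/idP/idP => [ri|].
    apply/negPn/negP => ni; move: (ni); rewrite stoppedE othersE (negbTE ni).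
    by rewrite -lerBlDr ri.
  move=> si; move: (si); rewrite stoppedE othersE si -lerBlDr.
  exact: le_trans (dec k).
move=> k0.
apply: eq_card => i; rewrite !inE; apply/idP/idP => [ri|].
  apply/negPn/negP => ni; move: (ni); rewrite stoppedE othersE (negbTE ni).
  by rewrite -lerBlDr (le_trans (dec k) ri).
move=> si; move: (si); by rewrite stoppedE othersE si -lerBlDr.
Qed.

(** * The distribution of a signal near a transversal solution *)

Lemma density_is_derive (R : realType) (F f : R -> R) :
  continuous f -> (forall x, 0 <= f x) ->
  (forall y, (F y)%:E =
     (\int[lebesgue_measure]_(x in `]-oo, y]) (f x)%:E)%E) ->
  forall y : R, is_derive y 1 F (f y).
Proof.
move=> cf f0 FE y.
have mf : measurable_fun [set: R] f by exact: continuous_measurable_fun.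
have intf (u : R) : (@lebesgue_measure R).-integrable `]-oo, u] (EFin \o f).
  apply/integrableP; split.
    by apply/measurable_EFinP; exact: measurable_funTS.
  under eq_integral => x _ do rewrite /= ger0_norm ?f0 //.
  by rewrite -FE ltry.
have FE' : F = (fun z => \int[lebesgue_measure]_(x in `]-oo, z]) f x).
  by apply/funext => z; rewrite /Rintegral -FE.
have [] := @continuous_FTC1 R f -oo%O y (y + 1) _ (intf _) _ (cf y) => //.
  by rewrite ltrDl.
  by rewrite ltNyr.
by rewrite -FE' derive1E => dF <-; exact: DeriveDef.
Qed.

(** Continuity of F rules out an atom at y. *)
Lemma probability_ge (R : realType) (d : measure_display)
    (Omega : measurableType d) (P : probability Omega R) (X : Omega -> R)
    (F : R -> R) (y : R) :
  measurable_fun [set: Omega] X -> has_cdf P X F -> {for y, continuous F} ->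
  P [set w | y <= X w] = (1 - F y)%:E.
Proof.
move=> mX cdf cF.
have m_le z : measurable [set w | X w <= z].
  have := mX measurableT _ (measurable_itv `]-oo, z]); rewrite setTI.
  by congr measurable; apply/seteqP; split => w /=; rewrite in_itv.
have m_ge : measurable [set w | y <= X w].
  have := mX measurableT _ (measurable_itv `[y, +oo[); rewrite setTI.
  by congr measurable; apply/seteqP; split => w /=; rewrite in_itv /= andbT.
have Fsub z : (z < y) -> (P [set w | (y <= X w)%R] <= (1 - F z)%:E)%E.
  move=> zy.
  have <- : P (~` [set w | X w <= z]) = (1 - F z)%:E.
    by rewrite probability_setC // cdf EFinB.
  rewrite le_measure ?inE //; first exact: measurableC.
  by move=> w /= yX; apply/negP; rewrite -ltNge (lt_le_trans zy).
apply/eqP; rewrite eq_le; apply/andP; split; last first.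
  have <- : P (~` [set w | X w <= y]) = (1 - F y)%:E.
    by rewrite probability_setC // cdf EFinB.
  rewrite le_measure ?inE //; first exact: measurableC.
  by move=> w /= /negP; rewrite -ltNge => /ltW.
rewrite -[P _]fineK ?fin_num_measure // lee_fin.
apply/ler_addgt0Pr => e e0.
have /cvg_at_left_filter /cvgr_dist_lt /(_ e e0) : F z @[z --> y] --> F y by exact: cF.
move=> /(filterI (nbhs_left_lt y)) /filter_ex [z /= [zy]].
have := Fsub z zy; rewrite -[P _]fineK ?fin_num_measure // lee_fin => h.
by rewrite ltr_norml => /andP[h1 h2]; lra.
Qed.

(** The derivative of u + F (r - c u) at x is 1 - c f (r - c x), so a negative
    derivative means that c f (r - c x) > 1.  By continuity of f this persists
    near x with a slightly smaller constant l, and the mean value theorem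
    integrates it. *)
Lemma tail_expanding (R : realType) (F : R -> R) (r c x : R) :
  0 < c -> admits_continuous_density F ->
  strongly_decreasing_transversal F r c x ->
  continuous F /\ exists l e : R, [/\ 1 < l, 0 < e &
    forall a b, x - e <= a -> a <= b -> b <= x + e ->
      l * (b - a) <= F (r - c * a) - F (r - c * b)].
Proof.
move=> c0 [f [cf f0 FE]] [x01 gx dg g'x].
have dF := density_is_derive _ _ _ cf f0 FE.
have cF : continuous F.
  by move=> y; apply/differentiable_continuous/derivable1_diffP; case: (dF y).
split=> //.
pose phi u : R := r - c * u.
have dphi (u : R) : is_derive u 1 phi (- c).
  have -> : phi = cst r - c *: id by [].
  by apply: is_derive_eq; rewrite sub0r [c *: _]mulr1.
have dG (u : R) : is_derive u 1 (F \o phi) (- c * f (phi u)).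
  have dFu := dF (phi u).
  by have := is_derive1_comp dFu (dphi u); rewrite mulrN mulrC -mulNr.
have fx : 1 < c * f (phi x).
  have dg' : is_derive x 1 (fun u : R => u + F (r - c * u)) (1 - c * f (phi x)).
    by rewrite -mulNr; apply: is_deriveD.
  by move: g'x; rewrite derive1E derive_val subr_lt0.
pose l := (1 + c * f (phi x)) / 2.
have l1 : 1 < l by rewrite /l; lra.
have : \forall u \near x, l < c * f (phi u).
  have cphi : (fun u => c * f (phi u)) u @[u --> x] --> c * f (phi x).
    apply: cvgM; first exact: cvg_cst.
    apply: continuous_comp; last exact: cf.
    by apply/differentiable_continuous/derivable1_diffP; case: (dphi x).
  by apply: cvgr_gt cphi _ _; rewrite /l; lra.
move=> [e /= e0 He]; exists l, (e / 2); split => //; first by rewrite divr_gt0.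
move=> a b xa ab bx.
move: ab; rewrite le_eqVlt => /predU1P[<-|ab]; first by rewrite !subrr mulr0.
have cG : {within `[a, b], continuous (F \o phi)}.
  apply: continuous_subspaceT => u.
  by apply/differentiable_continuous/derivable1_diffP; case: (dG u).
have [u] := MVT ab (fun u _ => dG u) cG.
rewrite in_itv /= => /andP[au ub] E.
have lu : l < c * f (phi u).
  by apply: He; rewrite /ball /= ltr_norml; lra.
have E' : F (r - c * b) - F (r - c * a) = - c * f (phi u) * (b - a) := E.
rewrite -[leRHS]opprB E' !mulNr opprK.
by rewrite ler_wpM2r ?subr_ge0 ?ltW.
Qed.

(** * Uniform bounds near a transversal solution *)

(** The window is x - e1 <= j / n <= x + e1, where T u = 1 - F (r - c u) has
    growth rate at least l > 1 and T x = x.  The width e1 and the constant v are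
    chosen so that l (x - e1) exceeds T (x + e1) + v, which is the increment
    condition of [sample_no_downcrossing]; they depend on F and x only. *)
Lemma transversal_sample_no_downcrossing (R : realType) (d : measure_display)
    (Omega : measurableType d) (P : probability Omega R)
    (X : nat -> Omega -> R) (F : R -> R) (r c x : R) :
  (forall i, measurable_fun [set: Omega] (X i)) ->
  mutually_independent P X -> (forall i, has_cdf P (X i) F) ->
  0 < c -> admits_continuous_density F ->
  strongly_decreasing_transversal F r c x ->
  exists eps delta : R, [/\ 0 < eps, 0 < delta &
    \forall n \near \oo, exists A : set Omega, [/\ measurable A,
      (delta%:E <= P A)%E &
      forall w, A w -> forall k : nat, `|k%:R / n%:R - x| <= eps ->
        #|[pred i : 'I_n | r - c * (k%:R / n%:R) <= X i w]| = k ->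
        ((0 < k)%N ->
          #|[pred i : 'I_n | r - c * (k.-1%:R / n%:R) <= X i w]| = k) ->
        False]].
Proof.
move=> mX indX cdfX c0 dens trans.
have [cF [l [e [l1 e0 expand]]]] := tail_expanding _ _ _ _ _ c0 dens trans.
have [/andP[x0 x1] gx _ _] := trans.
pose T u := 1 - F (r - c * u).
have m_le y : measurable [set w | X 0%N w <= y].
  have := mX 0%N measurableT _ (measurable_itv `]-oo, y]); rewrite setTI.
  by congr measurable; apply/seteqP; split => w /=; rewrite in_itv.
have F01 y : 0 <= F y <= 1.
  by rewrite -!lee_fin -(cdfX 0%N) measure_ge0 probability_le1.
have T01 u : 0 <= T u <= 1 by have := F01 (r - c * u); rewrite /T; lra.
have Texp a b : x - e <= a -> a <= b -> b <= x + e -> l * (b - a) <= T b - T a.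
  by move=> xa ab bx; have := expand a b xa ab bx; rewrite /T; lra.
have Tx : T x = x by rewrite /T; lra.
(* T is nonnegative and decreases by at least l e from x to x - e, so x >= l e;
   in particular x - e is positive. *)
have xgt0 : 0 < x.
  have := Texp (x - e) x; have := T01 (x - e); rewrite Tx; nra.
pose m := (l - 1) * x.
have m0 : 0 < m by rewrite mulr_gt0 // subr_gt0.
have [eta eta0 Teta] : exists2 eta, 0 < eta & T (x + eta) < x + m / 4.
  have cT : T u @[u --> x] --> T x.
    apply: cvgB; first exact: cvg_cst.
    apply: (@continuous_comp _ _ _ (fun u => r - c * u) F); last exact: cF.
    by apply: cvgB; [exact: cvg_cst|apply: cvgM; [exact: cvg_cst|exact: cvg_id]].
  have : \forall u \near x, T u < x + m / 4.
    by apply: cvgr_lt cT _ _; rewrite Tx; lra.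
  move=> [h /= h0 Hh]; exists (h / 2); first by rewrite divr_gt0.
  apply: Hh; rewrite /ball /= opprD addrA subrr sub0r normrN ger0_norm; lra.
have Tmono a b : a <= b -> T a <= T b.
  move=> ab; rewrite /T lerD2l lerN2 -lee_fin -!(cdfX 0%N).
  rewrite le_measure ?inE // => w /= /le_trans; apply.
  by rewrite lerD2l lerN2 ler_pM2l.
pose e1 := Num.min e (Num.min eta (m / (4 * l))).
have e1_gt0 : 0 < e1.
  by rewrite /e1 !lt_min e0 eta0 divr_gt0 // mulr_gt0; lra.
have e1_le_e : e1 <= e by rewrite /e1 ge_min lexx.
have e1_le_eta : e1 <= eta by rewrite /e1 !ge_min lexx orbT.
have e1_le_m : l * e1 <= m / 4.
  have : e1 <= m / (4 * l) by rewrite /e1 !ge_min lexx !orbT.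
  rewrite ler_pdivlMr; last by lra.
  lra.
have Te1 : T (x + e1) < x + m / 4.
  by apply: le_lt_trans Teta; apply: Tmono; lra.
pose v := m / 4.
have v0 : 0 < v by rewrite divr_gt0.
exists (e1 / 2), (v / (1 + v) * ((l - 1) * e1 / 2)); split.
- by rewrite divr_gt0.
- by rewrite !mulr_gt0 ?invr_gt0 ?subr_gt0 //; lra.
apply: filterS (nbhs_infty_gtr (2 / e1)) => n.
rewrite ltr_pdivrMr // => n_large.
have n0 : 0 < n%:R :> R by nra.
have xe1 : 0 <= n%:R * (x - e1).
  rewrite mulr_ge0 ?subr_ge0 ?ltW //.
  have := Texp (x - e) x; have := T01 (x - e); rewrite Tx; nra.
(* The first index strictly inside the window, so that every k with
   |k / n - x| <= e1 / 2 is larger than k1 once n e1 > 2. *)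
pose k1 := (Num.truncn (n%:R * (x - e1))).+1.
pose k2 := Num.truncn (n%:R * (x + e1)).
have /andP[k1_le k1_gt] : n%:R * (x - e1) < k1%:R <= n%:R * (x - e1) + 1.
  have /andP[h1 h2] := truncn_itv xe1.
  by rewrite /k1 h2 /= -natr1 lerD2r.
have /andP[k2_le k2_gt] : k2%:R <= n%:R * (x + e1) < k2.+1%:R.
  by apply: truncn_itv; rewrite mulr_ge0 ?addr_ge0 ?ltW.
have k12 : (k1 <= k2)%N.
  rewrite -ltnS -(ltr_nat R); nra.
have windowl j : (k1 <= j)%N -> x - e1 < j%:R / n%:R.
  rewrite -(ler_nat R) ltr_pdivlMr // => ?; lra.
have windowr j : (j <= k2)%N -> j%:R / n%:R <= x + e1.
  rewrite -(ler_nat R) ler_pdivrMr // => ?; lra.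
have [||||||A [mA noA PA]] := sample_no_downcrossing _ _ _ P X
   (fun j => r - c * (j%:R / n%:R)) (fun j => T (j%:R / n%:R)) v n k1 k2 mX indX.
- by move=> j k jk; rewrite lerD2l lerN2 ler_pM2l // ler_pM2r ?invr_gt0 // ler_nat.
- by move=> i j; rewrite /T; apply: probability_ge => //; exact: cF.
- exact: ltW.
- exact: k12.
- move=> j /andP[/windowl j1 /windowr j2].
  have := Texp (x - e) (j%:R / n%:R); have := T01 (x - e); nra.
- move=> j /andP[k1j jk2].
  have j1 := windowl _ k1j; have j2 := windowr _ jk2.
  have step : j.+1%:R / n%:R - j%:R / n%:R = n%:R^-1 :> R.
    by rewrite -mulrBl -natr1 addrAC subrr add0r mul1r.
  have ninv : 0 < n%:R^-1 :> R by rewrite invr_gt0.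
  have inc : l * n%:R^-1 <= T (j.+1%:R / n%:R) - T (j%:R / n%:R).
    by have := Texp (j%:R / n%:R) (j.+1%:R / n%:R); rewrite step; lra.
  have upper : T (j.+1%:R / n%:R) <= x + m / 4.
    by apply: le_trans (ltW Te1); exact: Tmono.
  apply: (@le_trans _ _ (j%:R * (l * n%:R^-1))); last exact: ler_wpM2l.
  rewrite mulrCA; apply: (@le_trans _ _ (l * (x - e1))); last first.
    have l0 : 0 < l by lra.
    by rewrite ler_pM2l // ltW.
  by move: e1_le_m upper m0; rewrite /v /m; lra.
exists A; split => //.
  apply: le_trans PA; rewrite lee_fin; apply: ler_wpM2l.
    by rewrite divr_ge0 //; lra.
  have k1n : k1.+1%:R <= n%:R :> R by rewrite -natr1; nra.
  have kappa := windowl _ (leqnn k1).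
  have kx : k1%:R / n%:R <= x by rewrite ler_pdivrMr //; nra.
  have Tk : T (k1%:R / n%:R) <= x - l * (x - k1%:R / n%:R).
    by have := Texp (k1%:R / n%:R) x; rewrite Tx; lra.
  have : n%:R * T (k1%:R / n%:R) <= k1%:R - (l - 1) * (n%:R * x - k1%:R).
    apply: le_trans (ler_wpM2l (ltW n0) Tk) _.
    rewrite [leLHS](_ : _ = k1%:R - (l - 1) * (n%:R * x - k1%:R)) //.
    by field; rewrite gt_eqF.
  move=> nT; rewrite lerBrDl -lerBrDr ler_pdivrMr ?ltr0n //.
  apply: le_trans nT _.
  have q0 : 0 <= l - 1 by lra.
  have q1 : 0 <= (l - 1) * e1 / 2 by rewrite divr_ge0 // mulr_ge0 // ltW.
  (* The drift over the stretch from k1 to n x, of length at least n e1 / 2,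
     makes T (k1 / n) smaller than k1 / n. *)
  have slack : n%:R * e1 / 2 <= n%:R * x - k1%:R by lra.
  have := ler_wpM2l q0 slack; have := ler_wpM2l q1 k1n.
  by rewrite -natr1; lra.
move=> w Aw k; rewrite ler_norml => /andP[kl kr] Nk Nk1.
have k1k : (k1 < k)%N.
  have : x - e1 / 2 <= k%:R / n%:R by lra.
  by rewrite ler_pdivlMr // -(ltr_nat R) => ?; nra.
have kk2 : (k <= k2)%N.
  have : k%:R / n%:R <= x + e1 / 2 by lra.
  by rewrite ler_pdivrMr // -ltnS -(ltr_nat R) => ?; nra.
apply: (noA w Aw k); rewrite ?k1k //; apply: Nk1; exact: leq_trans k1k.
Qed.

(** * Non-convergence *)

Lemma sub_sigma_algebra_measurable_fun (R : realType) (d : measure_display)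
    (Omega : measurableType d) (S : set (set Omega)) (X : Omega -> R) :
  S `<=` measurable ->
  measurable_fun [set: g_sigma_algebraType S] (X : g_sigma_algebraType S -> R) ->
  measurable_fun [set: Omega] X.
Proof.
move=> Sm mX _ B mB.
have SSm : <<s S >> `<=` (measurable : set (set Omega)).
  by apply: smallest_sub => //; exact: sigma_algebra_measurable.
by apply: SSm; exact: (mX measurableT B mB).
Qed.

Lemma signal_measurable (R : realType) (d : measure_display)
    (Omega : measurableType d) (G : R -> set (set Omega)) (X : R -> Omega -> R)
    (t : R) :
  right_continuous_filtration G -> signal_process G X -> 0 <= t ->
  measurable_fun [set: Omega] (X t).
Proof.
move=> hG hX t0.
apply: sub_sigma_algebra_measurable_fun (filtration_measurable hG t0) _.
apply: (@measurable_comp _ _ _ _ _ _ (`[0, t] `*` [set: g_sigma_algebraType (G t)])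
  (fun z : R * g_sigma_algebraType (G t) => X z.1 z.2) setT
  (fun w : g_sigma_algebraType (G t) => (t, w))).
- by apply: measurableX => //; exact: measurableT.
- by move=> _ [w _ <-]; split => //=; rewrite in_itv /= t0 lexx.
- exact: (signal_progressive hX) t t0.
- exact: pair1_measurable.
Qed.

Theorem theorem6p6 (R : realType) (d dI : measure_display)
    (Omega : measurableType d) (P : probability Omega R)
    (G : R -> set (set Omega)) (hG : right_continuous_filtration G)
    (E : {RV P >-> R}) (hE : exponential_independent G E)
    (r c : R) (hc : 0 < c)
    (F : R -> R -> R)
    (hF : forall t : R, 0 <= t -> admits_continuous_density (F t))
    (Y : nat -> R -> Omega -> R) (hY : n_player_signals P G F Y)
    (I : measurableType dI) (lambda : probability I R)
    (hlambda : atomless lambda)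
    (Sigma : set (set (I * Omega)))
    (mu : probability (g_sigma_algebraType Sigma) R)
    (hmu : fubini_extension lambda P mu)
    (Z : I -> R -> Omega -> R) (hZ : mean_field_signals lambda P Sigma G F Z)
    (rho : R -> R) (hrho : mean_field_equilibrium lambda P G E r c Z rho)
    (hint : [set t : R | 0 <= t /\
               strongly_decreasing_transversal (F t) r c (rho t)]° !=set0) :
  ~ exists rho_ : nat -> R -> Omega -> R,
      (forall n : nat, (0 < n)%N -> n_player_equilibrium P G E r c Y n (rho_ n))
      /\ fatou_cvg_in_probability P rho_ rho.
Proof.
move=> [rho_ [eqm [D [D0 dense cvg]]]].
have [s sint] := hint.
have s0 : 0 <= s by have [] := interior_subset sint.
have clD : closure D s by apply: dense; rewrite /= in_itv /= s0.
have [t [Dt [t0 trans]]] := clD _ sint.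
have mY i : measurable_fun [set: Omega] (Y i t).
  exact: signal_measurable hG (n_player_signal_process hY i) t0.
have [eps [delta [eps0 delta0 large]]] := transversal_sample_no_downcrossing
  _ _ _ P (fun i => Y i t) (F t) r c (rho t) mY
  (n_player_signal_independent hY t0)
  (fun i => n_player_signal_cdf hY i t0) hc (hF t t0) trans.
have small : \forall n \near \oo,
    (P [set w | (eps < `|rho_ n t w - rho t|)%R] < delta%:E)%E.
  apply: (cvg t Dt eps eps0 [set z : \bar R | (z < delta%:E)%E]).
  apply: open_nbhs_nbhs; split; first exact: open_ereal_lt_ereal.
  by rewrite /= lte_fin.
have [n [[small_n [A [mA PA noA]]] n0]] :=
  filter_ex (filterI (filterI small large) (nbhs_infty_gt 0)).
have : (P A <= P [set w | (eps < `|rho_ n t w - rho t|)%R])%E.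
  have mrho : measurable_fun [set: Omega] (rho_ n t).
    apply: sub_sigma_algebra_measurable_fun (filtration_measurable hG t0) _.
    exact: (proj1 (eqm n n0)) t t0.
  rewrite le_measure ?inE //.
    have mdist : measurable_fun [set: Omega] (fun w => `|rho_ n t w - rho t|).
      by apply: measurableT_comp => //; exact: measurable_funB.
    have := mdist measurableT _ (measurable_itv `]eps, +oo[); rewrite setTI.
    by congr measurable; apply/seteqP; split => w /=; rewrite in_itv /= andbT.
  move=> w Aw /=; rewrite ltNge; apply/negP => near_rho.
  have [k [rhoE Nk Nk1]] := equilibrium_downcrossing _ _ _ _ _ _ _ _ _ _ _ _ w
    n0 hc t0 (n_player_signal_process hY) (eqm n n0).
  by rewrite rhoE in near_rho; exact: (noA w Aw k near_rho Nk Nk1).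
by move=> /(le_trans PA) /le_lt_trans /(_ small_n); rewrite ltxx.
Qed.
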